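(* Let $\cent$ denote the E-Capra coupling on $\mathbb{R}^d\times\mathbb{R}^d$, written $c$ below: $c(x,y)=\langle x,y\rangle/\|x\|$ if $x\neq 0$ and $c(0,y)=0$. Let $k\in\{0,1,\ldots,d\}$. Then, with the convention $\|\cdot\|^{tn}_{(0)}=0$, $$\delta_{\ell_0^{\leq k}}^{-c}=\delta_{\ell_0^{\leq k}}^{c}=\|\cdot\|^{tn}_{(k)},$$ $$\delta_{\ell_0^{\leq k}}^{cc'}=\delta_{\ell_0^{\leq k}},$$ $$\ell_0^{c}=\sup_{l=0,1,\ldots,d}\big[\|\cdot\|^{tn}_{(l)}-l\big],$$ $$\ell_0^{cc'}=\ell_0 .$$
   Context: $d\geq 1$ is an integer; $\mathbb{R}^d$ carries the scalar product $\langle\cdot,\cdot\rangle$ and the Euclidean norm $\|\cdot\|$. $\overline{\mathbb{R}}=[-\infty,+\infty]$. For a real-valued coupling $c:\mathbb{R}^d\times\mathbb{R}^d\to\mathbb{R}$ and functions $f,g:\mathbb{R}^d\to\overline{\mathbb{R}}$, the $c$-conjugate of $f$ is $f^{c}(y)=\sup_{x\in\mathbb{R}^d}\big(c(x,y)-f(x)\big)$, the reverse conjugate of $g$ is $g^{c'}(x)=\sup_{y\in\mathbb{R}^d}\big(c(x,y)-g(y)\big)$, and the $c$-biconjugate of $f$ is $f^{cc'}=(f^{c})^{c'}$. The notation $f^{-c}$ denotes the conjugate with respect to the coupling $-c$. $\ell_0(x)$ is the number of nonzero components of $x\in\mathbb{R}^d$ (the $\ell_0$ pseudonorm), and $\ell_0^{\leq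 k}=\{x\in\mathbb{R}^d:\ell_0(x)\leq k\}$. For a set $X\subset\mathbb{R}^d$, $\delta_X$ is the function equal to $0$ on $X$ and $+\infty$ outside $X$. For $K\subset\{1,\ldots,d\}$, $x_K$ is the vector that coincides with $x$ on indices in $K$ and vanishes on indices outside $K$. For $k\in\{1,\ldots,d\}$ the top-$k$ norm is $\|x\|^{tn}_{(k)}=\sup_{|K|\leq k}\|x_K\|$, the supremum being over subsets $K$ of $\{1,\ldots,d\}$. *)

(* Defs.v *)
From HB Require Import structures.
From mathcomp Require Import all_boot all_order all_algebra.
From mathcomp Require Import all_classical all_reals all_analysis.

Set Implicit Arguments.
Unset Strict Implicit.
Unset Printing Implicit Defensive.

Import Order.TTheory GRing.Theory Num.Theory.

Local Open Scope classical_set_scope.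
Local Open Scope ring_scope.

Section Conjugacy.
Context {R : realType} {X Y : Type}.

(* [c] is real-valued, so the differences below are never of the form
   (+oo) - (+oo) or (-oo) - (-oo). *)
Definition conjugate (c : X -> Y -> R) (f : X -> \bar R) (y : Y) : \bar R :=
  ereal_sup [set ((c x y)%:E - f x)%E | x in [set: X]].

Definition reverse_conjugate (c : X -> Y -> R) (g : Y -> \bar R) (x : X) :
    \bar R :=
  ereal_sup [set ((c x y)%:E - g y)%E | y in [set: Y]].

Definition biconjugate (c : X -> Y -> R) (f : X -> \bar R) : X -> \bar R :=
  reverse_conjugate c (conjugate c f).

Definition opp_coupling (c : X -> Y -> R) (x : X) (y : Y) : R := - c x y.

Definition delta (A : set X) (x : X) : \bar R :=
  if x \in A then 0%E else +oo%E.

End Conjugacy.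

Section Euclidean.
Context {R : realType} {d : nat}.
Implicit Types x y : 'rV[R]_d.

Definition dotp x y : R := \sum_(i < d) x 0 i * y 0 i.

(* The library norm on ['rV[R]_d] is the sup norm, not the Euclidean one. *)
Definition enorm x : R := Num.sqrt (dotp x x).

Definition ecapra x y : R := if x == 0 then 0 else dotp x y / enorm x.

Definition ell0_nat x : nat := #|[set i : 'I_d | x 0 i != 0]%SET|.

Definition ell0 x : \bar R := ((ell0_nat x)%:R)%:E.

Definition ell0_level (k : nat) : set 'rV[R]_d := [set x | (ell0_nat x <= k)%N].

Definition restrict_to (K : {set 'I_d}) x : 'rV[R]_d :=
  \row_i (if i \in K then x 0 i else 0).

(* For [k = 0] only the empty [K] is allowed and the value is 0
   (see [topnorm0]), as the usual convention requires. *)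
Definition topnorm (k : nat) x : R :=
  sup [set enorm (restrict_to K x) | K in [set K : {set 'I_d} | (#|K| <= k)%N]].

Lemma topnorm0 x : topnorm 0 x = 0.
Proof.
rewrite /topnorm; set A := (X in sup X).
have -> : A = [set 0].
  have E : enorm (restrict_to finset.set0 x) = 0.
    rewrite /enorm /dotp big1 ?sqrtr0// => i _.
    by rewrite mxE finset.in_set0 mul0r.
  apply/seteqP; split => [r [K /= hK <-]|r /= ->]; last first.
    by exists finset.set0 => //=; rewrite cards0.
  by move: hK; rewrite leqn0 cards_eq0 => /eqP ->.
exact: sup1.
Qed.

End Euclidean.

(* Main.v *)
Require Import Defs.
From mathcomp Require Import all_boot all_order all_algebra.
From mathcomp Require Import all_classical all_reals all_analysis.
From mathcomp Require Import ring lra.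

Import Order.TTheory GRing.Theory Num.Theory.

Local Open Scope classical_set_scope.
Local Open Scope ring_scope.

(** By Cauchy-Schwarz, [c(x, y) <= ||y_K||] when the support of [x] lies in
    [K], with equality for [x = y_K]; this gives the conjugates.  For the
    biconjugates, test with [y = t x], [t] large: if [#|K| < ell0 x] then [K]
    misses a nonzero component of [x], so [||x_K|| <= ||x|| - e] for some [e > 0]
    uniform in [K], and [c(x, t x) = t ||x||] exceeds the top-[l] norm of [t x]
    by at least [t e] for every [l < ell0 x]. *)

(** * Euclidean inner product, norm and the Cauchy-Schwarz inequality *)

Section InnerProduct.
Context {R : realType} {d : nat}.
Implicit Types (x y : 'rV[R]_d) (a : R) (K : {set 'I_d}).

Lemma dotp0l y : dotp 0 y = 0.
Proof. by rewrite /dotp big1 // => i _; rewrite mxE mul0r. Qed.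

Lemma dotpC x y : dotp x y = dotp y x.
Proof. by apply: eq_bigr => i _; rewrite mulrC. Qed.

Lemma dotpZl a x y : dotp (a *: x) y = a * dotp x y.
Proof.
by rewrite /dotp mulr_sumr; apply: eq_bigr => i _; rewrite mxE mulrA.
Qed.

Lemma dotpBl x y z : dotp (x - y) z = dotp x z - dotp y z.
Proof.
by rewrite /dotp -sumrB; apply: eq_bigr => i _; rewrite !mxE mulrBl.
Qed.

Lemma dotp_ge0 x : 0 <= dotp x x.
Proof. by apply: sumr_ge0 => i _; rewrite -expr2 sqr_ge0. Qed.

Lemma dotp_eq0 x : (dotp x x == 0) = (x == 0).
Proof.
apply/idP/eqP => [|->]; last by rewrite dotp0l.
rewrite psumr_eq0 => [/allP h|i _]; last by rewrite -expr2 sqr_ge0.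
apply/rowP => i; rewrite mxE; apply/eqP.
by have := h i (mem_index_enum i); rewrite /= mulf_eq0 orbb.
Qed.

Lemma enorm_ge0 x : 0 <= enorm x.
Proof. exact: sqrtr_ge0. Qed.

Lemma sqr_enorm x : enorm x ^+ 2 = dotp x x.
Proof. by rewrite sqr_sqrtr // dotp_ge0. Qed.

Lemma enorm_gt0 x : (0 < enorm x) = (x != 0).
Proof. by rewrite sqrtr_gt0 lt0r dotp_ge0 andbT dotp_eq0. Qed.

Lemma enorm0 : enorm (0 : 'rV[R]_d) = 0.
Proof. by rewrite /enorm dotp0l sqrtr0. Qed.

Lemma enormZ a x : 0 <= a -> enorm (a *: x) = a * enorm x.
Proof.
move=> a0; rewrite /enorm dotpZl dotpC dotpZl mulrA -expr2 sqrtrM ?sqr_ge0 //.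
by rewrite sqrtr_sqr ger0_norm.
Qed.

Lemma enormN x : enorm (- x) = enorm x.
Proof. by congr Num.sqrt; apply: eq_bigr => i _; rewrite !mxE mulrNN. Qed.

Lemma cauchy_schwarz x y : dotp x y <= enorm x * enorm y.
Proof.
have [->|x0] := eqVneq x 0; first by rewrite dotp0l enorm0 mul0r.
apply: (le_trans (ler_norm _)).
rewrite -(@ler_pXn2r _ 2) ?nnegrE ?mulr_ge0 ?enorm_ge0 //.
rewrite exprMn !sqr_enorm -normrX ger0_norm ?sqr_ge0 //.
have xx : 0 < dotp x x by rewrite lt0r dotp_eq0 x0 dotp_ge0.
(* This squared norm equals [dotp x x * (dotp x x * dotp y y - dotp x y ^+ 2)], and its first factor
   is positive. *)
have := dotp_ge0 (dotp x x *: y - dotp x y *: x).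
rewrite dotpBl !dotpZl ![dotp _ (_ - _)]dotpC !dotpBl !dotpZl (dotpC y x) => h.
rewrite -(ler_pM2l xx) -subr_ge0; apply: le_trans h _.
by rewrite le_eqVlt; apply/orP; left; apply/eqP; ring.
Qed.

End InnerProduct.

(** * Restriction of vectors to a set of coordinates *)

Section Restriction.
Context {R : realType} {d : nat}.
Implicit Types (x y : 'rV[R]_d) (K : {set 'I_d}).

Lemma restrictZ K (a : R) x : restrict_to K (a *: x) = a *: restrict_to K x.
Proof. by apply/rowP => i; rewrite !mxE; case: ifP => // _; rewrite mulr0. Qed.

Lemma restrict_setC K x : x - restrict_to K x = restrict_to (~: K) x.
Proof.
apply/rowP => i; rewrite !mxE finset.in_setC.
by case: ifP; rewrite ?subrr ?subr0.
Qed.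

Lemma dotp_restrict K x y :
  dotp (restrict_to K x) y = dotp (restrict_to K x) (restrict_to K y).
Proof. by apply: eq_bigr => i _; rewrite !mxE; case: ifP; rewrite ?mul0r. Qed.

Lemma enorm_pythagoras K x :
  enorm (restrict_to K x) ^+ 2 + enorm (restrict_to (~: K) x) ^+ 2 =
  enorm x ^+ 2.
Proof.
rewrite !sqr_enorm -!dotp_restrict -restrict_setC dotpBl.
by rewrite addrC subrK.
Qed.

Lemma enorm_restrict_le K x : enorm (restrict_to K x) <= enorm x.
Proof.
rewrite -(@ler_pXn2r _ 2) ?nnegrE ?enorm_ge0 // -(enorm_pythagoras K x).
by rewrite lerDl sqr_ge0.
Qed.

(** By Pythagoras, equality would make [x] vanish outside [K], so the support of [x] would lie in
    [K] and be no larger than it. *)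
Lemma enorm_restrict_lt K x :
  (#|K| < ell0_nat x)%N -> enorm (restrict_to K x) < enorm x.
Proof.
move=> Kx; rewrite -(@ltr_pXn2r _ 2) ?nnegrE ?enorm_ge0 //.
rewrite -(enorm_pythagoras K x) ltrDl exprn_gt0 // enorm_gt0.
apply: contraTneq Kx => x0; rewrite -leqNgt subset_leq_card //.
apply/fintype.subsetP => i; rewrite inE; apply: contraNT => iK.
by move/rowP: x0 => /(_ i); rewrite !mxE finset.in_setC iK => ->.
Qed.

Lemma restrict_gap x : exists2 e : R, 0 < e &
  forall K, (#|K| < ell0_nat x)%N -> enorm (restrict_to K x) <= enorm x - e.
Proof.
(* A minimum over finitely many [K] of positive numbers; the seed 1 keeps it positive when no [K]
   qualifies, that is for [x = 0]. *)
exists (\big[Num.min/1]_(K : {set 'I_d} | (#|K| < ell0_nat x)%N)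
          (enorm x - enorm (restrict_to K x))).
  by apply: lt_bigmin => [|K Kx]; rewrite ?ltr01 // subr_gt0 enorm_restrict_lt.
by move=> K Kx; rewrite lerBrDr addrC -lerBrDr; exact: bigmin_le_cond.
Qed.

Lemma ell0_nat_restrict K x : (ell0_nat (restrict_to K x) <= #|K|)%N.
Proof.
apply/subset_leq_card/fintype.subsetP => i; rewrite inE mxE.
by case: ifP; rewrite ?eqxx.
Qed.

Lemma ell0_natN x : ell0_nat (- x) = ell0_nat x.
Proof. by apply: eq_card => i; rewrite !inE mxE oppr_eq0. Qed.

Lemma ell0_nat_le_dim x : (ell0_nat x <= d)%N.
Proof. by rewrite -[leqRHS]card_ord max_card. Qed.

End Restriction.

(** * Top-k norms *)

Section TopNorm.
Context {R : realType} {d : nat}.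
Implicit Types (x y : 'rV[R]_d) (K : {set 'I_d}) (k l : nat).

Lemma topnorm_ge k K y :
  (#|K| <= k)%N -> enorm (restrict_to K y) <= topnorm k y.
Proof.
move=> Kk; apply: ub_le_sup; last by exists K.
by exists (enorm y) => _ [L _ <-]; exact: enorm_restrict_le.
Qed.

(** There are finitely many candidates [K], and the empty set is always one of them. *)
Lemma topnorm_attained k y : exists2 K : {set 'I_d},
  (#|K| <= k)%N & topnorm k y = enorm (restrict_to K y).
Proof.
have k0 : (#|finset.set0 : {set 'I_d}| <= k)%N by rewrite cards0.
have [] := @Order.TotalTheory.arg_maxP _ _ _ _
  (fun K : {set 'I_d} => (#|K| <= k)%N) (fun K => enorm (restrict_to K y)) k0.
move=> K Kk Kmax; exists K => //; apply/eqP; rewrite eq_le; apply/andP; split.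
  apply: ge_sup => [|_ [L Lk <-]]; last exact: Kmax.
  by exists (enorm (restrict_to K y)), K.
by apply: topnorm_ge.
Qed.

Lemma topnorm_ge0 k y : 0 <= topnorm k y.
Proof. by have [K _ ->] := topnorm_attained k y; exact: enorm_ge0. Qed.

Lemma topnorm_le_enorm k y : topnorm k y <= enorm y.
Proof. by have [K _ ->] := topnorm_attained k y; exact: enorm_restrict_le. Qed.

(** The gap [e] is chosen before [t] and [l], so along the ray of [x] it grows linearly in [t]; both
    biconjugates rest on this. *)
Lemma topnorm_gap x : exists2 e : R, 0 < e & forall (t : R) l, 0 <= t ->
  (l < ell0_nat x)%N -> topnorm l (t *: x) <= t * (enorm x - e).
Proof.
have [e e0 gap] := restrict_gap x; exists e => // t l t0 lx.
have [K Kl ->] := topnorm_attained l (t *: x).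
by rewrite restrictZ enormZ // ler_wpM2l // gap // (leq_ltn_trans Kl).
Qed.

End TopNorm.

(** * The E-Capra coupling *)

Section Coupling.
Context {R : realType} {d : nat}.
Implicit Types (x y : 'rV[R]_d) (K : {set 'I_d}) (k l : nat).

(** The value 0 prescribed at [x = 0] agrees with the quotient, whose numerator vanishes there. *)
Lemma ecapraE x y : ecapra x y = dotp x y / enorm x.
Proof.
by rewrite /ecapra; case: eqP => // ->; rewrite dotp0l mul0r.
Qed.

Lemma ecapraNl x y : ecapra (- x) y = - ecapra x y.
Proof.
by rewrite !ecapraE enormN -scaleN1r dotpZl mulN1r mulNr.
Qed.

Lemma ecapra_scale_self (t : R) x : ecapra x (t *: x) = t * enorm x.
Proof.
rewrite ecapraE dotpC dotpZl -sqr_enorm expr2.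
have [->|x0] := eqVneq (enorm x) 0; first by rewrite !(mulr0, mul0r).
by rewrite mulrA mulfK.
Qed.

(** Equality case of Cauchy-Schwarz: only the coordinates of [y] in [K] enter the product. *)
Lemma ecapra_restrict K y :
  ecapra (restrict_to K y) y = enorm (restrict_to K y).
Proof.
rewrite ecapraE dotp_restrict -ecapraE -[X in ecapra _ X]scale1r.
by rewrite ecapra_scale_self mul1r.
Qed.

Lemma ecapra_le_topnorm k x y :
  (ell0_nat x <= k)%N -> ecapra x y <= topnorm k y.
Proof.
move=> xk; have [->|x0] := eqVneq x 0.
  by rewrite /ecapra eqxx topnorm_ge0.
rewrite ecapraE ler_pdivrMr ?enorm_gt0 //.
(* On the support [K] of [x], [y] can be replaced by its restriction before applying
   Cauchy-Schwarz. *)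
set K := [set i : 'I_d | x 0 i != 0]%SET.
have -> : dotp x y = dotp x (restrict_to K y).
  apply: eq_bigr => i _; rewrite !mxE inE.
  by case: eqVneq => // ->; rewrite !mul0r.
apply: (le_trans (cauchy_schwarz _ _)).
by rewrite mulrC ler_wpM2r ?enorm_ge0 // topnorm_ge.
Qed.

End Coupling.

(** Fenchel-Young inequality, rearranged; as [c] is finite, the rearrangement survives infinite
    values of [f] and of its conjugate. *)
Lemma biconjugate_le (R : realType) (X Y : Type) (c : X -> Y -> R)
  (f : X -> \bar R) (x : X) : (biconjugate c f x <= f x)%E.
Proof.
apply: ge_ereal_sup => _ [y _ <-].
have : ((c x y)%:E - f x <= conjugate c f y)%E.
  by apply: ereal_sup_ubound; exists x.
by case: (f x) => [r| |]; case: (conjugate c f y) => [s| |] //=;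
  rewrite ?leey ?leNye // !lee_fin => h; lra.
Qed.

(** * Conjugates and biconjugates of the level-set indicator and of [ell0] *)

Section Conjugates.
Context {R : realType} {d : nat}.
Implicit Types (x y : 'rV[R]_d) (k l : nat).

Lemma delta_ell0_level k x :
  delta (ell0_level k) x = if (ell0_nat x <= k)%N then 0%E else +oo%E :> \bar R.
Proof. by rewrite /delta; congr (if _ then _ else _); apply/asboolP/idP. Qed.

Lemma conjugate_delta_ell0_level k y :
  conjugate ecapra (delta (ell0_level k)) y = (topnorm k y)%:E.
Proof.
apply/eqP; rewrite eq_le; apply/andP; split.
  apply: ge_ereal_sup => _ [x _ <-]; rewrite delta_ell0_level.
  case: ifPn => [xk|_]; last by rewrite leNye.
  by rewrite sube0 lee_fin; exact: ecapra_le_topnorm.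
have [K Kk ->] := topnorm_attained k y.
apply: ereal_sup_ubound; exists (restrict_to K y) => //.
rewrite delta_ell0_level ifT ?sube0 ?ecapra_restrict //.
exact: leq_trans (ell0_nat_restrict _ _) Kk.
Qed.

(** The coupling is odd in [x] and the level set is symmetric, so [x] can be reindexed as [- x]. *)
Lemma conjugate_opp_delta_ell0_level k y :
  conjugate (opp_coupling ecapra) (delta (ell0_level k)) y =
  conjugate ecapra (delta (ell0_level k)) y.
Proof.
have deltaN x : delta (ell0_level k) (- x) = delta (ell0_level k) x :> \bar R.
  by rewrite !delta_ell0_level ell0_natN.
congr ereal_sup; apply/seteqP; split=> _ [x _ <-]; exists (- x) => //.
- by rewrite ecapraNl deltaN.
- by rewrite /opp_coupling ecapraNl opprK deltaN.
Qed.

Lemma conjugate_ell0 y : conjugate ecapra ell0 y =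
  ereal_sup [set (topnorm l y - l%:R)%:E | l in [set l : nat | (l <= d)%N]].
Proof.
apply/eqP; rewrite eq_le; apply/andP; split.
  apply: ge_ereal_sup => _ [x _ <-]; apply: le_ereal_sup_tmp.
  exists (topnorm (ell0_nat x) y - (ell0_nat x)%:R)%:E.
    by exists (ell0_nat x) => //=; exact: ell0_nat_le_dim.
  by rewrite lee_fin lerD2r ecapra_le_topnorm.
apply: ge_ereal_sup => _ [l _ <-]; have [K Kl ->] := topnorm_attained l y.
apply: le_ereal_sup_tmp; set x := restrict_to K y.
(* The restriction [x] may have fewer than [l] nonzero components, which only raises this term. *)
exists (ecapra x y - (ell0_nat x)%:R)%:E; first by exists x.
rewrite lee_fin ecapra_restrict lerD2l lerN2 ler_nat.
exact: leq_trans (ell0_nat_restrict _ _) Kl.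
Qed.

Lemma biconjugate_delta_ell0_level k x :
  biconjugate ecapra (delta (ell0_level k)) x = delta (ell0_level k) x.
Proof.
apply/eqP; rewrite eq_le biconjugate_le /= {1}delta_ell0_level.
case: leqP => [_|kx].
  apply: le_ereal_sup_tmp.
  (* At [y = 0] both the coupling and the top-k norm vanish, which gives the lower bound 0. *)
  pose y : 'rV[R]_d := 0.
  exists ((ecapra x y)%:E - conjugate ecapra (delta (ell0_level k)) y)%E.
    by exists y.
  rewrite conjugate_delta_ell0_level -EFinB lee_fin subr_ge0 /y.
  by rewrite -[X in ecapra _ X](scale0r x) ecapra_scale_self mul0r
    (le_trans (topnorm_le_enorm k 0)) ?enorm0.
have [e e0 gap] := topnorm_gap x.
rewrite leye_eq; apply/eqP/eqyP => A A0; apply: le_ereal_sup_tmp.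
(* The scaling turns the gap [e] into exactly [A], an arbitrary positive bound. *)
set y := (A / e) *: x.
exists ((ecapra x y)%:E - conjugate ecapra (delta (ell0_level k)) y)%E.
  by exists y.
have t0 : 0 <= A / e by rewrite divr_ge0 // ltW.
rewrite conjugate_delta_ell0_level -EFinB lee_fin ecapra_scale_self.
have := gap _ _ t0 kx; rewrite mulrBr divfK ?gt_eqF // -/y; lra.
Qed.

Lemma biconjugate_ell0 x : biconjugate ecapra ell0 x = ell0 x.
Proof.
apply/eqP; rewrite eq_le biconjugate_le /=.
have [e e0 gap] := topnorm_gap x; set m := ell0_nat x in gap.
(* With [t * e = m], the gap pays the penalty [m] for every [l < m]; for [l >= m] the term [- l]
   already does. *)
set t : R := m%:R / e; have t0 : 0 <= t by rewrite divr_ge0 // ltW.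
have conj_le : (conjugate ecapra ell0 (t *: x) <= (t * enorm x - m%:R)%:E)%E.
  rewrite conjugate_ell0; apply: ge_ereal_sup => _ [l _ <-]; rewrite lee_fin.
  have [ml|lm] := leqP m l.
    by rewrite lerB ?ler_nat // -enormZ // topnorm_le_enorm.
  have := gap _ _ t0 lm; rewrite mulrBr divfK ?gt_eqF //.
  by have := ler0n R l; lra.
apply: le_ereal_sup_tmp.
exists ((ecapra x (t *: x))%:E - conjugate ecapra ell0 (t *: x))%E.
  by exists (t *: x).
rewrite ecapra_scale_self; apply: le_trans (leeB (lexx _) conj_le).
by rewrite -EFinB lee_fin /ell0 -/m; lra.
Qed.

End Conjugates.

Theorem theorem3p5 (R : realType) (d : nat) (hd : (1 <= d)%N)
    (k : nat) (hk : (k <= d)%N) :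
  let c : 'rV[R]_d -> 'rV[R]_d -> R := ecapra in
  let dk : 'rV[R]_d -> \bar R := delta (ell0_level k) in
  [/\ conjugate (opp_coupling c) dk = conjugate c dk
        /\ conjugate c dk = (fun y => (topnorm k y)%:E),
      biconjugate c dk = dk,
      conjugate c ell0 =
        (fun y => ereal_sup
           [set (topnorm l y - l%:R)%:E | l in [set l : nat | (l <= d)%N]])
    & biconjugate c ell0 = ell0].
Proof.
split.
- split; apply/funext => y; first exact: conjugate_opp_delta_ell0_level.
  exact: conjugate_delta_ell0_level.
- by apply/funext => x; exact: biconjugate_delta_ell0_level.
- by apply/funext => y; exact: conjugate_ell0.
- by apply/funext => x; exact: biconjugate_ell0.
Qed.
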